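(* Let $c>\frac12$ and $\delta>0$ be fixed. Let $\ell\ge3$ and let $\ell_1,\ell_2,\ell_3$ be positive integers with $\ell_1+\ell_2+\ell_3=\ell$. For $\mathbf y_1,\dots,\mathbf y_{\ell-2}\in\mathbb R^n$ and $\varepsilon_1,\dots,\varepsilon_{\ell-2}\in\{1,-1\}$ consider $$V_n^{-2\ell c}\int_{\mathbb R^n}\int_{\mathbb R^n}f_{c,\delta}(\mathbf x_1)\prod_{i=1}^{\ell_1-1}f_{c,\delta}(\varepsilon_i\mathbf x_1+\mathbf y_i)\; f_{c,\delta}(\mathbf x_2)\prod_{i=\ell_1}^{\ell_1+\ell_2-2}f_{c,\delta}(\varepsilon_i\mathbf x_2+\mathbf y_i)\prod_{i=\ell_1+\ell_2-1}^{\ell-2}f_{c,\delta}\big(\varepsilon_i(\mathbf x_1+\mathbf x_2)+\mathbf y_i\big)\,d\mathbf x_1\,d\mathbf x_2 .$$ There exist constants $K>0$ and $0<\rho<1$, depending only on $\ell,c,\delta$ (and not on $n$, the $\varepsilon_i$ or the $\mathbf y_i$), such that this integral is at most $K\rho^n$ for all $n\ge1$, all $\varepsilon_i$ and all $\mathbf y_i$.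
   Context: $V_n=\pi^{n/2}/\Gamma(\frac n2+1)$ is the volume of the unit ball in $\mathbb R^n$, $R_n(\delta)=(\delta/V_n)^{1/n}$, and $f_{c,\delta}(\mathbf x)=|\mathbf x|^{-2cn}$ if $|\mathbf x|>R_n(\delta)$, $f_{c,\delta}(\mathbf x)=0$ otherwise. Empty products equal $1$. *)

(* Defs.v *)
From HB Require Import structures.
From mathcomp Require Import all_boot all_order all_algebra.
From mathcomp Require Import all_classical all_reals all_analysis.
Set Implicit Arguments. Unset Strict Implicit. Unset Printing Implicit Defensive.
Import Order.TTheory GRing.Theory Num.Theory.
Import numFieldNormedType.Exports.
Local Open Scope classical_set_scope.
Local Open Scope ring_scope.

Section Defs.
Variable R : realType.

Definition Gamma (s : R) : R :=
  Rintegral lebesgue_measure `]0, +oo[%classic (fun t => t `^ (s - 1) * expR (- t)).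

(* V_n = pi^(n/2) / Gamma(n/2 + 1), volume of the unit ball of R^n *)
Definition Vn (n : nat) : R := pi `^ (n%:R / 2) / Gamma (n%:R / 2 + 1).

Definition Rn (n : nat) (delta : R) : R := (delta / Vn n) `^ (n%:R)^-1.

Definition enorm (n : nat) (x : 'rV[R]_n) : R := Num.sqrt (\sum_(i < n) x ord0 i ^+ 2).

Definition fcd (n : nat) (c delta : R) (x : 'rV[R]_n) : R :=
  if Rn n delta < enorm x then enorm x `^ (- (2 * c * n%:R)) else 0.

Definition cons_rv (k : nat) (x : R) (v : 'rV[R]_k) : 'rV[R]_k.+1 :=
  \row_(i < k.+1) match unlift ord0 i with Some j => v ord0 j | None => x end.

(* Lebesgue integral over R^n of a nonnegative extended-real function,
   computed as the iterated one-dimensional Lebesgue integral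
   (equal to the integral w.r.t. n-dimensional Lebesgue measure for
   nonnegative measurable functions, by Tonelli). *)
Fixpoint intRn (n : nat) : ('rV[R]_n -> \bar R) -> \bar R :=
  match n return ('rV[R]_n -> \bar R) -> \bar R with
  | 0 => fun F => F (const_mx 0)
  | k.+1 => fun F => (\int[lebesgue_measure]_(x in setT)
                         intRn (fun v => F (cons_rv x v)))%E
  end.

Definition sgn (b : bool) : R := if b then 1 else -1.

End Defs.

(* Main.v *)
(* Write [s = 2c], let [r] be the cutoff radius and [B = r^(-sn)] the supremum of [f = f_{c,delta}].
   All but three of the factors, [f x1], [f x2] and [f x3] with [x3 = x1 + x2 + y], are bounded
   by [B].  Since [s > 1], the mass of [f] is concentrated, up to an exponentially small
   proportion, on [r < |x| <= r tau] for any fixed [tau > 1].  If all three norms are in that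
   range, then [|x1|^2 = x3.x1 - x2.x1 - y.x1] makes one of [x3.x1], [-x2.x1], [-y.x1] at least
   [r^2/4], which puts one of the three points in a cap of the ball, itself contained in a
   smaller ball and hence of exponentially small relative volume.  In every case one factor has
   exponentially small mass, another is integrable, and the third is at most [B].
   Volumes are only needed up to an arbitrarily small exponential loss [q^n], [q > 1]: balls are
   dominated by Gaussians, the tails of [f] by geometric series of Gaussians, and [V_n] is
   compared with [(2 pi e / n)^(n/2)] by a crude upper bound on the Gamma function. *)
Require Import Defs.
From HB Require Import structures.
From mathcomp Require Import all_boot all_order all_algebra.
From mathcomp Require Import all_classical all_reals all_analysis.
From mathcomp Require Import measurable_realfun ring lra zify.
Set Implicit Arguments. Unset Strict Implicit. Unset Printing Implicit Defensive.
Import Order.TTheory GRing.Theory Num.Theory.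
Local Open Scope ring_scope.

(** * Iterated integrals *)

Section IteratedIntegral.
Context {R : realType}.
Local Notation mu := (@lebesgue_measure R).
Local Open Scope ereal_scope.

(** The integral of a nonnegative function is a supremum over the simple functions below it, and
    this family grows with the function. The integrand of the theorem can thus be compared directly
    with measurable majorants. *)
Lemma integral_mono (f g : R -> \bar R) : (forall x, 0 <= f x) ->
  (forall x, f x <= g x) -> \int[mu]_x f x <= \int[mu]_x g x.
Proof.
move=> f0 fg; have g0 x : 0 <= g x by exact: le_trans (fg x).
rewrite !ge0_integralTE//; apply: le_ereal_sup => _ [h hf <-]; exists h => // x.
exact: le_trans (hf x) (fg x).
Qed.

Lemma intRn_ge0 n (F : 'rV[R]_n -> \bar R) : (forall x, 0 <= F x) -> 0 <= intRn F.
Proof.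
elim: n F => [|n IH] F F0 /=; first exact: F0.
by apply: integral_ge0 => x _; exact: IH.
Qed.

Lemma intRn_mono n (F G : 'rV[R]_n -> \bar R) : (forall x, 0 <= F x) ->
  (forall x, F x <= G x) -> intRn F <= intRn G.
Proof.
elim: n F G => [|n IH] F G F0 FG /=; first exact: FG.
by apply: integral_mono => x; [exact: intRn_ge0|exact: IH].
Qed.

(* The part of measurability of [F] that the iterated integral sees. *)
Fixpoint slice_measurable (n : nat) : ('rV[R]_n -> \bar R) -> Prop :=
  match n return ('rV[R]_n -> \bar R) -> Prop with
  | 0 => fun=> True
  | k.+1 => fun F => (forall x, slice_measurable (fun v => F (cons_rv x v))) /\
      measurable_fun setT ((fun x => intRn (fun v => F (cons_rv x v))) : R -> \bar R)
  end.

(** Both conclusions go through one induction: measurability in the first coordinate follows from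
    the integral formula on the slices. The next two lemmas have the same shape for the same
    reason. *)
Lemma intRnZl_slice n (a : \bar R) (F : 'rV[R]_n -> \bar R) : 0 <= a ->
  (forall x, 0 <= F x) -> slice_measurable F ->
  slice_measurable (fun x => a * F x) /\ intRn (fun x => a * F x) = a * intRn F.
Proof.
move=> a0; elim: n F => [|n IH] F F0 //= [sF mF].
have sl x := IH _ (fun v => F0 (cons_rv x v)) (sF x).
have -> : (fun x => intRn (fun v => a * F (cons_rv x v))) =
          (fun x => a * intRn (fun v => F (cons_rv x v))).
  by apply/funext => x; exact: (sl x).2.
split; first by split; [move=> x; exact: (sl x).1|exact: measurable_funeM].
by apply: ge0_integralZl => //= x _; exact: intRn_ge0.
Qed.

Lemma intRnD_slice n (F G : 'rV[R]_n -> \bar R) :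
  (forall x, 0 <= F x) -> (forall x, 0 <= G x) ->
  slice_measurable F -> slice_measurable G ->
  slice_measurable (fun x => F x + G x) /\
  intRn (fun x => F x + G x) = intRn F + intRn G.
Proof.
elim: n F G => [|n IH] F G F0 G0 //= [sF mF] [sG mG].
have sl x := IH _ _ (fun v => F0 (cons_rv x v)) (fun v => G0 (cons_rv x v)) (sF x) (sG x).
have -> : (fun x => intRn (fun v => F (cons_rv x v) + G (cons_rv x v))) =
          (fun x => intRn (fun v => F (cons_rv x v)) + intRn (fun v => G (cons_rv x v))).
  by apply/funext => x; exact: (sl x).2.
split; first by split; [move=> x; exact: (sl x).1|exact: emeasurable_funD].
by apply: ge0_integralD => //= x _; exact: intRn_ge0.
Qed.

Lemma intRn_nneseries_slice n (F : nat -> 'rV[R]_n -> \bar R) :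
  (forall k x, 0 <= F k x) -> (forall k, slice_measurable (F k)) ->
  slice_measurable (fun x => \sum_(k <oo) F k x) /\
  intRn (fun x => \sum_(k <oo) F k x) = \sum_(k <oo) intRn (F k).
Proof.
elim: n F => [|n IH] F F0 //= sF.
have sl x := IH _ (fun k v => F0 k (cons_rv x v)) (fun k => (sF k).1 x).
have -> : (fun x => intRn (fun v => \sum_(k <oo) F k (cons_rv x v))) =
          (fun x => \sum_(k <oo) intRn (fun v => F k (cons_rv x v))).
  by apply/funext => x; exact: (sl x).2.
split.
  split; first by move=> x; exact: (sl x).1.
  apply: ge0_emeasurable_sum => [k x _ _|k _]; first exact: intRn_ge0.
  exact: (sF k).2.
apply: integral_nneseries => //= [k|k x _]; first exact: (sF k).2.
exact: intRn_ge0.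
Qed.

Lemma integral_gauss1 (a m : R) : (0 < a)%R ->
  \int[mu]_x (expR (- a * (x - m) ^+ 2))%:E = (Num.sqrt (pi / a))%:E.
Proof.
(* With variance [s ^+ 2 = 1 / (2a)], the integrand is the normal density divided by its peak. *)
move=> a0; pose s := Num.sqrt (a *+ 2)^-1.
have a20 : (0 < (a *+ 2)^-1)%R by rewrite invr_gt0 mulrn_wgt0.
have s2 : (s ^+ 2 = (a *+ 2)^-1)%R by rewrite sqr_sqrtr ?ltW.
have s0 : s != 0%R by rewrite gt_eqF// sqrtr_gt0.
have pk0 := normal_peak_gt0 s0.
have pkE : ((normal_peak s)^-1 = Num.sqrt (pi / a))%R.
  rewrite /normal_peak invrK s2; congr (Num.sqrt _).
  by field; rewrite gt_eqF.
have E x : (expR (- a * (x - m) ^+ 2))%:E =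
    ((normal_peak s)^-1)%R%:E * (normal_pdf m s x)%:E :> \bar R.
  rewrite -EFinM normal_pdfE// mulKf ?gt_eqF// /normal_fun s2.
  congr (expR _)%:E; field; by rewrite gt_eqF.
under eq_integral do rewrite E.
rewrite ge0_integralZl//=.
- by rewrite integral_normal_pdf mule1 pkE.
- by apply/measurable_EFinP; exact: measurable_normal_pdf.
- by move=> x _; rewrite lee_fin normal_pdf_ge0.
- by rewrite lee_fin invr_ge0 ltW.
Qed.

Definition gauss n (a : R) (m x : 'rV[R]_n) : R :=
  expR (- a * \sum_(i < n) (x ord0 i - m ord0 i) ^+ 2).

Lemma gauss_cons n a (m : 'rV[R]_n.+1) x v : gauss a m (cons_rv x v) =
  (expR (- a * (x - m ord0 ord0) ^+ 2) *
   gauss a (\row_i m ord0 (lift ord0 i)) v)%R.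
Proof.
rewrite /gauss -expRD -mulrDr big_ord_recl !mxE unlift_none.
by under eq_bigr do rewrite !mxE liftK; under [in RHS]eq_bigr do rewrite mxE.
Qed.

Lemma intRn_gauss_slice n (a : R) (m : 'rV[R]_n) : (0 < a)%R ->
  slice_measurable (fun x => (gauss a m x)%:E) /\
  intRn (fun x => (gauss a m x)%:E) = (Num.sqrt (pi / a) ^+ n)%:E.
Proof.
move=> a0; elim: n m => [|n IH] m /=; first by rewrite /gauss big_ord0 mulr0 expR0.
set m' := (\row_i m ord0 (lift ord0 i))%R.
have E x : (fun v => (gauss a m (cons_rv x v))%:E) =
  (fun v => (expR (- a * (x - m ord0 ord0) ^+ 2))%:E * (gauss a m' v)%:E).
  by apply/funext => v; rewrite gauss_cons EFinM.
have sl x := @intRnZl_slice n (_%:E) (fun v => (gauss a m' v)%:E)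
  (expR_ge0 (- a * (x - m ord0 ord0) ^+ 2)) (fun v => expR_ge0 _) (IH m').1.
have mf : measurable_fun setT (fun x : R => (expR (- a * (x - m ord0 ord0) ^+ 2))%:E).
  apply/measurable_EFinP; apply: measurableT_comp => //.
  by apply: measurable_funM => //; apply: measurable_funX; exact: measurable_funB.
have -> : (fun x => intRn (fun v => (gauss a m (cons_rv x v))%:E)) =
  (fun x => (Num.sqrt (pi / a) ^+ n)%:E * (expR (- a * (x - m ord0 ord0) ^+ 2))%:E).
  by apply/funext => x; rewrite E (sl x).2 (IH m').2 muleC.
split.
  split=> [x|]; first by rewrite E; exact: (sl x).1.
  exact: measurable_funeM.
rewrite ge0_integralZl//= ?integral_gauss1 -?EFinM ?exprSr//.
Qed.

End IteratedIntegral.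

(** * A lower bound on the volume of the ball *)

Section GammaBound.
Context {R : realType}.
Local Notation mu := (@lebesgue_measure R).

(** In terms of [z := b * t / h] this is [z <= expR (z - 1)] raised to the power [h]. The factor
    [expR (- (1 - b) * t)] is held back to make the bound integrable. *)
Lemma powR_expR_le (h b t : R) : 0 < h -> 0 < b -> 0 < t ->
  t `^ h * expR (- t) <= (h / b) `^ h * expR (- h) * expR (- (1 - b) * t).
Proof.
move=> h0 b0 t0; pose z := b * t / h.
have z0 : 0 < z by rewrite divr_gt0 ?mulr_gt0.
have hb0 : 0 < h / b by rewrite divr_gt0.
have -> : t = h / b * z by rewrite /z; field; rewrite !gt_eqF.
rewrite powRM ?(ltW hb0) ?(ltW z0)// -[leLHS]mulrA -[leRHS]mulrA ler_pM2l ?powR_gt0//.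
have zh : z `^ h <= expR (h * (z - 1)).
  rewrite [h * _]mulrC expRM; apply: (ge0_ler_powR (ltW h0)).
  - by rewrite nnegrE ltW.
  - by rewrite nnegrE expR_ge0.
  by have := expR_ge1Dx (z - 1); rewrite addrC subrK.
apply: le_trans (ler_wpM2r (expR_ge0 _) zh) _.
rewrite -!expRD ler_expR le_eqVlt; apply/orP; left; apply/eqP.
by field; rewrite gt_eqF.
Qed.

Lemma Gamma_le (h b : R) : 0 < h -> 0 < b -> b < 1 ->
  Gamma (h + 1) <= (h / b) `^ h * expR (- h) / (1 - b).
Proof.
move=> h0 b0 b1; have b10 : 0 < 1 - b by rewrite subr_gt0.
set C := (h / b) `^ h * expR (- h).
have C0 : 0 <= C by rewrite mulr_ge0 ?powR_ge0 ?expR_ge0.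
have int_le : (\int[mu]_(t in `]0%R, +oo[) (t `^ (h + 1 - 1) * expR (- t))%:E
    <= (C / (1 - b))%:E)%E.
  rewrite integral_mkcond -[leRHS]mule1 -(integral_exponential_pdf b10).
  rewrite -ge0_integralZl//=.
  - apply: integral_mono => x.
      rewrite patchE; case: ifP => // _; rewrite lee_fin.
      by apply: mulr_ge0; [exact: powR_ge0|exact: expR_ge0].
    rewrite patchE -EFinM; case: ifPn; last first.
      move=> _; change (0 <= (C / (1 - b) * exponential_pdf (1 - b) x)%:E)%E.
      rewrite lee_fin mulr_ge0 ?(divr_ge0 C0 (ltW b10))//.
      exact/exponential_pdf_ge0/ltW.
    rewrite inE/= in_itv/= andbT => x0.
    rewrite exponential_pdfE ?(ltW x0)// lee_fin mulrA divfK ?gt_eqF// addrK.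
    exact: powR_expR_le.
  - by apply/measurable_EFinP; exact: measurable_exponential_pdf.
  - by move=> x _; rewrite lee_fin exponential_pdf_ge0// ltW.
  - by rewrite lee_fin divr_ge0// ltW.
(* [Gamma] is the [fine] part of an extended integral; the bounds on both sides exclude the infinite
   values. *)
rewrite /Gamma /Rintegral; move: int_le.
have : (0 <= \int[mu]_(t in `]0%R, +oo[) (t `^ (h + 1 - 1) * expR (- t))%:E)%E.
  by apply: integral_ge0 => x _; rewrite lee_fin mulr_ge0 ?powR_ge0 ?expR_ge0.
by case: (integral _ _ _).
Qed.

Lemma Gamma_ge0 (s : R) : 0 <= Gamma s.
Proof.
apply: fine_ge0; apply: integral_ge0 => x _.
by rewrite lee_fin mulr_ge0 ?powR_ge0 ?expR_ge0.
Qed.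

Lemma Vn_ge0 n : 0 <= Vn R n.
Proof. by rewrite divr_ge0 ?powR_ge0 ?Gamma_ge0. Qed.

(* [ball_scale n ^+ n] is [(2 pi e / n)^(n/2)], the Stirling approximation of [Vn n]. *)
Definition ball_scale n : R := expR 2^-1 * Num.sqrt (2 * pi / n%:R).

Lemma ball_scale_ge0 n : 0 <= ball_scale n.
Proof. by rewrite mulr_ge0 ?expR_ge0. Qed.

(** Take [h = n / 2] and [b = q ^- 2] in [Gamma_le]: the loss in the power term is then exactly
    [q ^+ n]. *)
Lemma ball_scale_le_Vn n (q : R) : (0 < n)%N -> 1 < q -> Vn R n != 0 ->
  ball_scale n ^+ n <= (1 - q ^- 2)^-1 * q ^+ n * Vn R n.
Proof.
move=> n0 q1 V0; have q0 : 0 < q by exact: lt_trans q1.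
have nR0 : 0 < n%:R :> R by rewrite ltr0n.
pose h : R := n%:R / 2; have h0 : 0 < h by rewrite divr_gt0.
(* Since the inverse of [0] is [0], a vanishing [Gamma (h + 1)] would force [Vn R n = 0]. *)
have G0 : 0 < Gamma (h + 1).
  rewrite lt_neqAle Gamma_ge0 andbT eq_sym; apply: contra V0 => /eqP G0.
  by rewrite /Vn -/h G0 invr0 mulr0.
have b0 : 0 < q ^- 2 by rewrite invr_gt0 exprn_gt0.
have b1 : q ^- 2 < 1 by rewrite invf_lt1 ?exprn_gt0// exprn_egt1.
have nh : n%:R = h * 2 by rewrite /h divfK.
have hq : (h / q ^- 2) `^ h = h `^ h * q ^+ n.
  rewrite powRM ?invr_ge0 ?(ltW h0) ?exprn_ge0 ?(ltW q0)// invrK; congr (_ * _).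
  by rewrite -powR_mulrn ?(ltW q0)// -powRrM mulrC -nh powR_mulrn ?(ltW q0).
have := Gamma_le h0 b0 b1; rewrite hq => GL.
have -> : ball_scale n ^+ n = expR h * pi `^ h / h `^ h.
  rewrite exprMn -expRM_natr -[RHS]mulrA [2^-1 * _]mulrC -/h; congr (_ * _).
  rewrite -powR12_sqrt ?divr_ge0 ?mulr_ge0 ?pi_ge0//.
  rewrite -powR_mulrn ?powR_ge0// -powRrM [2^-1 * _]mulrC.
  have -> : 2 * pi / n%:R = pi / h by rewrite /h; field; rewrite gt_eqF.
  rewrite -/h powRM ?invr_ge0 ?pi_ge0 ?(ltW h0)//; congr (_ * _).
  by rewrite -powR_inv1 ?(ltW h0)// -powRrM mulN1r powRN.
rewrite /Vn -/h ler_pdivrMr ?powR_gt0// mulrA mulrAC ler_pdivlMr//.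
have E0 := expR_gt0 h; have P0 : 0 < pi `^ h :> R by rewrite powR_gt0 ?pi_gt0.
have : expR h * pi `^ h * Gamma (h + 1) <=
  expR h * pi `^ h * (h `^ h * q ^+ n * expR (- h) / (1 - q ^- 2)).
  by rewrite ler_pM2l// mulr_gt0.
move=> /le_trans; apply; rewrite expRN le_eqVlt; apply/orP; left; apply/eqP.
have b10 : 1 - q ^- 2 != 0 by rewrite subr_eq0 gt_eqF.
move: (expR h) E0 (1 - q ^- 2) b10 => e e0 d d0; field; by rewrite d0 gt_eqF.
Qed.

End GammaBound.

(** * Gaussian majorants *)

Lemma powR_exprn (R : realType) (x a : R) k : 0 <= x -> (x ^+ k) `^ a = (x `^ a) ^+ k.
Proof.
by move=> x0; rewrite -(powR_mulrn k x0) -(powR_mulrn k (powR_ge0 x a)) powRAC.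
Qed.

Section Majorants.
Import numFieldNormedType.Exports.
Context {R : realType} (n : nat) (n0 : (0 < n)%N).
Implicit Types (r q p : R) (m x : 'rV[R]_n).

Lemma sqr_enorm m : enorm m ^+ 2 = \sum_(i < n) m ord0 i ^+ 2.
Proof. by rewrite sqr_sqrtr// sumr_ge0// => i _; exact: sqr_ge0. Qed.

Lemma gaussE a m x : gauss a m x = expR (- a * enorm (x - m) ^+ 2).
Proof.
by rewrite /gauss sqr_enorm; under [in RHS]eq_bigr do rewrite !mxE.
Qed.

(** Among the Gaussians centred at [m] that equal 1 on the sphere of radius [r], the rate
    [n / (2 r^2)] gives the least total mass. *)
Definition ball_majorant r m x : R :=
  expR (n%:R / 2) * gauss (n%:R / (2 * r ^+ 2)) m x.

Lemma ball_majorant_ge0 r m x : 0 <= ball_majorant r m x.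
Proof. by rewrite mulr_ge0 ?expR_ge0. Qed.

Lemma ball_majorant_ge1 r m x : 0 < r -> enorm (x - m) ^+ 2 <= r ^+ 2 ->
  1 <= ball_majorant r m x.
Proof.
move=> r0 xr; rewrite /ball_majorant gaussE -expRD -[leLHS]expR0 ler_expR.
have r20 : 0 < r ^+ 2 by rewrite exprn_gt0.
have -> : n%:R / 2 + - (n%:R / (2 * r ^+ 2)) * enorm (x - m) ^+ 2 =
    n%:R / (2 * r ^+ 2) * (r ^+ 2 - enorm (x - m) ^+ 2).
  by field; rewrite gt_eqF.
by rewrite mulr_ge0 ?subr_ge0// divr_ge0 ?mulr_ge0// ltW.
Qed.

Lemma intRn_ball_majorant_slice r m : 0 < r ->
  slice_measurable (fun x => (ball_majorant r m x)%:E) /\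
  intRn (fun x => (ball_majorant r m x)%:E) = ((ball_scale n * r) ^+ n)%:E.
Proof.
move=> r0; set a := n%:R / (2 * r ^+ 2).
have nR0 : 0 < n%:R :> R by rewrite ltr0n.
have r20 : 0 < r ^+ 2 by rewrite exprn_gt0.
have a0 : 0 < a by rewrite divr_gt0 ?mulr_gt0.
have [sg Ig] := @intRn_gauss_slice R n a m a0.
have := @intRnZl_slice R n _%:E (fun x => (gauss a m x)%:E) (expR_ge0 (n%:R / 2))
  (fun x => expR_ge0 _) sg.
rewrite Ig -EFinM => -[sb Ib]; split; first exact: sb.
rewrite /ball_majorant; under eq_fun do rewrite EFinM.
rewrite Ib; congr (_%:E).
have -> : pi / a = 2 * pi / n%:R * r ^+ 2.
  by rewrite /a; field; rewrite !gt_eqF.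
rewrite sqrtrM ?divr_ge0 ?mulr_ge0 ?pi_ge0// sqrtr_sqr ger0_norm ?ltW//.
by rewrite /ball_scale -[in RHS]mulrA [RHS]exprMn -expRM_natr [2^-1 * _]mulrC.
Qed.

(* Geometric shells turn the power tail into a sum of Gaussians. *)
Definition tail_majorant q p r m x : \bar R :=
  (\sum_(k <oo) ((r * q ^+ k) `^ (- p) * ball_majorant (r * q ^+ k.+1) m x)%:E)%E.

Lemma tail_majorant_term_ge0 q p r m k x :
  (0 <= ((r * q ^+ k) `^ (- p) * ball_majorant (r * q ^+ k.+1) m x)%:E)%E.
Proof. by rewrite lee_fin mulr_ge0 ?powR_ge0 ?ball_majorant_ge0. Qed.

Lemma tail_majorant_ge0 q p r m x : (0 <= tail_majorant q p r m x)%E.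
Proof. by apply: nneseries_ge0 => k _ _; exact: tail_majorant_term_ge0. Qed.

(** A single term suffices: for the least [k] with [enorm (x - m) <= r * q ^+ k.+1], minimality, or
    the hypothesis on [r] when [k = 0], gives [r * q ^+ k <= enorm (x - m)]. *)
Lemma le_tail_majorant q p r m x : 1 < q -> 0 < r -> 0 <= p ->
  r <= enorm (x - m) -> ((enorm (x - m) `^ (- p))%:E <= tail_majorant q p r m x)%E.
Proof.
move=> q1 r0 p0; set N := enorm _ => rN.
have q0 : 0 < q by exact: lt_trans q1.
have exk : exists k, N <= r * q ^+ k.+1.
  have : (q ^- k @[k --> \oo] --> (0 : R))%classic.
    under eq_cvg do rewrite -exprVn.
    by apply: cvg_expr; rewrite ger0_norm ?invr_ge0 ?(ltW q0)// invf_lt1.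
  have e0 : 0 < r / (N + 1) by rewrite divr_gt0// ltr_wpDl ?(le_trans (ltW r0)).
  move=> /cvgrPdist_lt/(_ _ e0)[k _ /(_ k.+1 (leqnSn k))] /=.
  rewrite sub0r normrN ger0_norm ?invr_ge0 ?exprn_ge0 ?(ltW q0)// => H.
  exists k; move: H; rewrite ltr_pdivlMr ?ltr_wpDl ?(le_trans (ltW r0))//.
  rewrite mulrC ltr_pdivrMr ?exprn_gt0// => /ltW; apply: le_trans.
  by rewrite lerDl.
case: (ex_minnP exk) => k Nk kmin.
apply: le_trans (nneseries_lim_ge k.+1 _); last first.
  by move=> i _ _; exact: tail_majorant_term_ge0.
rewrite big_nat_recr//= -[leLHS]add0e leeD//.
  by apply: sume_ge0 => i _; exact: tail_majorant_term_ge0.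
have rk : r * q ^+ k <= N.
  case: k Nk kmin => [|k] Nk kmin; first by rewrite mulr1.
  by rewrite leNgt; apply/negP => /ltW/kmin; rewrite ltnn.
have rk0 : 0 < r * q ^+ k by rewrite mulr_gt0 ?exprn_gt0.
rewrite lee_fin -[leLHS]mulr1 ler_pM ?powR_ge0//.
  rewrite !powRN lef_pV2 ?posrE ?powR_gt0 ?(lt_le_trans rk0)//.
  by apply: (ge0_ler_powR p0) => //; rewrite nnegrE ?(ltW rk0) ?(le_trans (ltW rk0)).
apply: ball_majorant_ge1; first by rewrite mulr_gt0 ?exprn_gt0.
by rewrite ler_sqr ?nnegrE ?sqrtr_ge0// mulr_ge0 ?exprn_ge0 ?ltW.
Qed.

Lemma intRn_tail_majorant_slice q s r m : 1 < q -> 0 < r -> 1 < s ->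
  slice_measurable (tail_majorant q (s * n%:R) r m) /\
  (intRn (tail_majorant q (s * n%:R) r m) <=
   ((1 - q `^ (1 - s))^-1 * ((ball_scale n * q) ^+ n * r `^ ((1 - s) * n%:R)))%:E)%E.
Proof.
move=> q1 r0 s1; have q0 : 0 < q by exact: lt_trans q1.
set p := s * n%:R.
have nR1 : 1 <= n%:R :> R by rewrite ler1n.
pose F k x := ((r * q ^+ k) `^ (- p) * ball_majorant (r * q ^+ k.+1) m x)%:E.
have rq0 k : 0 < r * q ^+ k by rewrite mulr_gt0 ?exprn_gt0.
have sF k : slice_measurable (F k) /\
    intRn (F k) = ((r * q ^+ k) `^ (- p) * (ball_scale n * (r * q ^+ k.+1)) ^+ n)%:E.
  have [sb Ib] := intRn_ball_majorant_slice m (rq0 k.+1).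
  rewrite /F; under eq_fun do rewrite EFinM.
  have := @intRnZl_slice R n _%:E (fun x => (ball_majorant (r * q ^+ k.+1) m x)%:E)
    (powR_ge0 (r * q ^+ k) (- p))
    (fun x => ball_majorant_ge0 (r * q ^+ k.+1) m x) sb.
  by rewrite Ib -EFinM.
have [sT IT] := intRn_nneseries_slice (fun k => tail_majorant_term_ge0 q p r m k)
  (fun k => (sF k).1).
split; first exact: sT.
rewrite /tail_majorant IT.
(* The masses of the shells form a geometric series of ratio [z]. As [n >= 1], [z] is at most its
   value for [n = 1], which makes the constant independent of [n]. *)
pose z := q `^ ((1 - s) * n%:R).
have z0 : 0 <= z by exact: powR_ge0.
have zs : z <= q `^ (1 - s).
  rewrite ler_powR ?(ltW q1)// -[leRHS]mulr1 ler_wnM2l// subr_le0 ltW//.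
have s10 : q `^ (1 - s) < 1.
  by rewrite /powR gt_eqF// expR_lt1 nmulr_rlt0 ?subr_lt0// ln_gt0.
have z1 : z < 1 by exact: le_lt_trans s10.
set C := (ball_scale n * q) ^+ n * r `^ ((1 - s) * n%:R).
have C0 : 0 <= C.
  by rewrite mulr_ge0 ?powR_ge0// exprn_ge0// mulr_ge0 ?ball_scale_ge0 ?ltW.
have E k : intRn (F k) = (C * z ^+ k)%:E.
  rewrite (sF k).2; congr (_%:E); rewrite /C.
  have -> : ball_scale n * (r * q ^+ k.+1) = ball_scale n * q * (r * q ^+ k).
    by rewrite exprS; ring.
  rewrite exprMn mulrCA -mulrA; congr (_ * _).
  rewrite -[X in _ * X]powR_mulrn ?(ltW (rq0 k))// -powRD; last first.
    by rewrite (gt_eqF (rq0 k)) implybT.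
  have -> : - p + n%:R = (1 - s) * n%:R by rewrite /p; ring.
  rewrite powRM ?exprn_ge0 ?ltW//; congr (_ * _).
  by rewrite powR_exprn ?(ltW q0).
have -> : (\sum_(k <oo) intRn (F k) = (C / (1 - z))%:E)%E.
  under eq_eseriesr do rewrite E.
  have z1' : `|z| < 1 by rewrite ger0_norm.
  have cg := @cvg_geometric_series R C z z1'.
  have -> : (C / (1 - z))%:E = (limn (series (geometric C z)))%:E by rewrite (cvg_lim _ cg).
  rewrite -EFin_lim; last by apply/cvg_ex; exists (C / (1 - z)).
  by apply: congr_lim; apply/funext => k /=; rewrite sumEFin.
rewrite lee_fin mulrC ler_wpM2r// lef_pV2 ?posrE ?subr_gt0//.
by rewrite lerD2l lerN2.
Qed.

End Majorants.

(** * Calculus of majorants with bounded mass *)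

Section MassBound.
Context {R : realType} (n : nat).
Implicit Types (F G : 'rV[R]_n -> \bar R) (a b c : \bar R).
Local Open Scope ereal_scope.

(** Slice measurability is carried along so that majorants can be added and scaled inside the
    iterated integral. *)
Definition mass_le F c :=
  [/\ forall x, 0 <= F x, slice_measurable F & intRn F <= c].

Lemma mass_leD F G a b : mass_le F a -> mass_le G b ->
  mass_le (fun x => F x + G x) (a + b).
Proof.
move=> [F0 sF Fa] [G0 sG Gb]; have [sFG IFG] := intRnD_slice F0 G0 sF sG.
split=> // [x|]; first exact: adde_ge0.
by rewrite IFG leeD.
Qed.

Lemma mass_leZ F a c : 0 <= a -> mass_le F c -> mass_le (fun x => a * F x) (a * c).
Proof.
move=> a0 [F0 sF Fc]; have [saF IaF] := intRnZl_slice a0 F0 sF.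
split=> // [x|]; first exact: mule_ge0.
by rewrite IaF lee_wpmul2l.
Qed.

Lemma mass_leW F a b : a <= b -> mass_le F a -> mass_le F b.
Proof. by move=> ab [F0 sF Fa]; split=> //; exact: le_trans ab. Qed.

Lemma intRn_le_mass F G c : (forall x, 0 <= F x) -> (forall x, F x <= G x) ->
  mass_le G c -> intRn F <= c.
Proof. by move=> F0 FG [_ _]; apply: le_trans; exact: intRn_mono. Qed.

End MassBound.

(** * Inner products and caps of balls *)

Section Geometry.
Context {R : realType} (n : nat).
Implicit Types (u v w x y : 'rV[R]_n).

Definition dot u v : R := \sum_(i < n) u ord0 i * v ord0 i.

Lemma sqr_enorm_dot u : enorm u ^+ 2 = dot u u.
Proof. by rewrite sqr_enorm; apply: eq_bigr => i _; rewrite expr2. Qed.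

Lemma dotC u v : dot u v = dot v u.
Proof. by apply: eq_bigr => i _; rewrite mulrC. Qed.

Lemma dotDl u v w : dot (u + v) w = dot u w + dot v w.
Proof. by rewrite -big_split; apply: eq_bigr => i _; rewrite mxE mulrDl. Qed.

Lemma dotZl a u v : dot (a *: u) v = a * dot u v.
Proof. by rewrite mulr_sumr; apply: eq_bigr => i _; rewrite mxE mulrA. Qed.

Lemma dotNl u v : dot (- u) v = - dot u v.
Proof. by rewrite -scaleN1r dotZl mulN1r. Qed.

(** A sign can be moved from the variable to the shift, which brings the third factor to the form
    [f (x1 + x2 + y)]. *)
Lemma enorm_scale_sgn b u y : enorm (sgn R b *: u + y) = enorm (u + sgn R b *: y).
Proof.
congr (Num.sqrt _); apply: eq_bigr => i _; rewrite !mxE /sgn.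
by case: b; rewrite ?mul1r// !mulN1r -sqrrN opprD opprK.
Qed.

(** In each coordinate the two sides differ by the sum of the squares of the pairwise
    differences. *)
Lemma sqr_enorm_sum3 u v w : enorm (u + v + w) ^+ 2 <=
  3 * (enorm u ^+ 2 + enorm v ^+ 2 + enorm w ^+ 2).
Proof.
rewrite !sqr_enorm -!big_split mulr_sumr; apply: ler_sum => i _; rewrite !mxE /=.
move: (u _ _) (v _ _) (w _ _) => a b c.
have := sqr_ge0 (a - b); have := sqr_ge0 (a - c); have := sqr_ge0 (b - c); nra.
Qed.

(* [|x - t w|^2 = |x|^2 - 2 t x.w + t^2 |w|^2] at [t = 1/64]. *)
Lemma cap_in_ball (N : R) x w : enorm x ^+ 2 <= N * (1 + 512^-1) ->
  enorm w ^+ 2 <= 16 * N -> N / 4 <= dot x w ->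
  enorm (x - 64^-1 *: w) ^+ 2 <= N * (1 - 512^-1).
Proof.
rewrite !sqr_enorm_dot -scaleNr => xN wN xw.
have -> : dot (x + (- 64^-1) *: w) (x + (- 64^-1) *: w) =
    dot x x - 32^-1 * dot x w + 4096^-1 * dot w w.
  rewrite dotDl ![dot _ (_ + _)]dotC !dotDl !dotZl ![dot _ (_ *: _)]dotC !dotZl.
  by rewrite [dot w x]dotC; field.
(* The three hypotheses add up to exactly [N * (1 + (1 - 4 + 2) / 512)]. *)
lra.
Qed.

End Geometry.

(** * The integral of three factors *)

Section TripleBound.
Context {R : realType} (n : nat) (c delta q : R).
Hypotheses (n0 : (0 < n)%N) (hc : 1 / 2 < c) (q1 : 1 < q).
Hypothesis r0 : 0 < Rn n delta.
Local Notation f := (@fcd R n c delta).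
Local Notation r := (Rn n delta).
Local Notation p := (2 * c * n%:R).
Local Notation B := (r `^ (- p)).
Variables tau sig : R.
Hypotheses (tau0 : 0 < tau) (tau2 : tau ^+ 2 = 1 + 512^-1).
Hypotheses (sig0 : 0 < sig) (sig2 : sig ^+ 2 = 1 - 512^-1).
(** As functions of [x], these dominate [f (x - m)] everywhere, where [x - m] has norm at least
    [r * tau], and on a cap; the last is centred at the smaller ball containing the cap. *)
Local Notation g := (tail_majorant q p r).
Local Notation gt := (tail_majorant q p (r * tau)).
Local Notation b := (fun m x => (B * ball_majorant (r * sig) m x)%:E).

Let p0 : 0 <= p. Proof. rewrite mulr_ge0//. have := hc; lra. Qed.
Let B0 : 0 <= B. Proof. exact: powR_ge0. Qed.

Lemma fcd_ge0 x : 0 <= f x.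
Proof. by rewrite /fcd; case: ifP => // _; exact: powR_ge0. Qed.

Lemma fcd_le x : f x <= B.
Proof.
rewrite /fcd; case: ifPn => // rx.
rewrite !powRN lef_pV2 ?posrE; last exact/powR_gt0/r0; last first.
  exact/powR_gt0/(lt_trans r0).
by apply: (ge0_ler_powR p0); rewrite ?nnegrE ?sqrtr_ge0 ?ltW.
Qed.

Lemma fcd_le_tail m x : ((f (x - m)%R)%:E <= g m x)%E.
Proof.
rewrite /fcd; case: ifPn => rx; last exact: tail_majorant_ge0.
by apply: le_tail_majorant => //; exact: ltW.
Qed.

Lemma fcd_le_far m x : r * tau <= enorm (x - m) -> ((f (x - m)%R)%:E <= gt m x)%E.
Proof.
move=> rx; rewrite /fcd; case: ifPn => _; last exact: tail_majorant_ge0.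
by apply: le_tail_majorant => //; rewrite mulr_gt0.
Qed.

Lemma fcd_le_cap m w x : enorm (x - m) <= r * tau -> enorm w ^+ 2 <= 16 * r ^+ 2 ->
  r ^+ 2 / 4 <= dot (x - m) w -> ((f (x - m)%R)%:E <= b (m + 64^-1 *: w)%R x)%E.
Proof.
move=> xt wr xw; rewrite lee_fin; apply: le_trans (fcd_le _) _.
rewrite -[leLHS]mulr1 ler_wpM2l// ball_majorant_ge1// ?mulr_gt0//.
rewrite opprD addrA exprMn sig2 cap_in_ball//.
by rewrite -tau2 -exprMn ler_sqr ?nnegrE ?sqrtr_ge0// mulr_ge0 ?ltW.
Qed.

(** One summand for each case. Those in which the light factor is at [x2] or at the third point are
    functions of [x2] for fixed [x1], paired with [g 0 x1]; those in which it is at [x1] are paired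
    with [g 0 x2]. The centres may depend on [x1], but the masses do not. *)
Lemma fcd_triple_le y x1 x2 :
  ((f x1 * f x2 * f (x1 + x2 + y)%R)%:E <=
   B%:E * (g 0%R x1 * (gt 0%R x2 + gt (- (x1 + y))%R x2
                       + b (- 64^-1 *: x1) x2 + b (- (x1 + y) + 64^-1 *: x1)%R x2)
           + (gt 0%R x1 + b (- 64^-1 *: y)%R x1) * g 0%R x2))%E.
Proof.
(* For fixed [x1] the third point is the translate [x2 - m3]. *)
pose m3 := - (x1 + y).
have x3E : x1 + x2 + y = x2 - m3 by rewrite /m3 opprK addrA [x2 + x1]addrC.
have x1E : x1 = x1 - 0 by rewrite subr0.
have x2E : x2 = x2 - 0 by rewrite subr0.
have f0 := fcd_ge0.
have g0 (m x : 'rV[R]_n) : (0 <= g m x)%E by exact: tail_majorant_ge0.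
have t0 (m x : 'rV[R]_n) : (0 <= gt m x)%E by exact: tail_majorant_ge0.
have b0 (m x : 'rV[R]_n) : (0 <= b m x)%E by rewrite lee_fin mulr_ge0 ?ball_majorant_ge0.
(* In [via12] and [via2] the factor bounded by [B] is the one at the third point, in [via3] the one
   at [x2]. *)
have via12 : ((f x1)%:E <= gt 0 x1 + b (- 64^-1 *: y)%R x1 ->
  (f x1 * f x2 * f (x1 + x2 + y)%R)%:E <=
  B%:E * ((gt 0 x1 + b (- 64^-1 *: y)%R x1) * g 0 x2))%E.
  move=> H; rewrite EFinM muleC; apply: lee_pmul => //; rewrite ?lee_fin ?mulr_ge0 ?fcd_le//.
  rewrite EFinM; apply: lee_pmul => //; rewrite ?lee_fin//.
  by rewrite [in leLHS]x2E; exact: fcd_le_tail.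
have via2 (S : \bar R) : ((f x2)%:E <= S ->
  (f x1 * f x2 * f (x1 + x2 + y)%R)%:E <= B%:E * (g 0 x1 * S))%E.
  move=> H; rewrite EFinM muleC; apply: lee_pmul => //; rewrite ?lee_fin ?mulr_ge0 ?fcd_le//.
  rewrite EFinM; apply: lee_pmul => //; rewrite ?lee_fin//.
  by rewrite [in leLHS]x1E; exact: fcd_le_tail.
have via3 (S : \bar R) : ((f (x1 + x2 + y)%R)%:E <= S ->
  (f x1 * f x2 * f (x1 + x2 + y)%R)%:E <= B%:E * (g 0 x1 * S))%E.
  move=> H; rewrite mulrAC EFinM muleC.
  apply: lee_pmul => //; rewrite ?lee_fin ?mulr_ge0 ?fcd_le//.
  rewrite EFinM; apply: lee_pmul => //; rewrite ?lee_fin//.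
  by rewrite [in leLHS]x1E; exact: fcd_le_tail.
set h := (gt 0 x1 + _)%E; set S := (_ + _ + _ + _)%E.
have h0 : (0 <= h)%E by exact: adde_ge0.
have S0 : (0 <= S)%E by rewrite !adde_ge0.
have leS (T : \bar R) : (T <= S)%E ->
    ((f x1 * f x2 * f (x1 + x2 + y)%R)%:E <= B%:E * (g 0 x1 * T))%E ->
    ((f x1 * f x2 * f (x1 + x2 + y)%R)%:E <= B%:E * (g 0 x1 * S + h * g 0 x2))%E.
  move=> TS /le_trans; apply; rewrite lee_wpmul2l ?lee_fin//.
  rewrite -[leLHS]adde0; apply: leeD; last exact: mule_ge0.
  exact: lee_wpmul2l.
have leh : ((f x1)%:E <= h)%E ->
    ((f x1 * f x2 * f (x1 + x2 + y)%R)%:E <= B%:E * (g 0 x1 * S + h * g 0 x2))%E.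
  move=> /via12/le_trans; apply; rewrite lee_wpmul2l ?lee_fin//.
  by rewrite -[leLHS]add0e; apply: leeD => //; exact: mule_ge0.
have zero : f x1 = 0 ->
    ((f x1 * f x2 * f (x1 + x2 + y)%R)%:E <= B%:E * (g 0 x1 * S + h * g 0 x2))%E.
  move=> ->; rewrite !mul0r mule_ge0 ?lee_fin// adde_ge0// mule_ge0//.
have [x1r|rx1] := leP (enorm x1) r.
  by apply: zero; rewrite /fcd ltNge x1r.
have [x1t|tx1] := leP (enorm x1) (r * tau); last first.
  apply: leh; rewrite -[leLHS]adde0 leeD//.
  by rewrite [in leLHS]x1E; apply: fcd_le_far; rewrite subr0 ltW.
have [x2t|tx2] := leP (enorm x2) (r * tau); last first.
  apply: leS (via2 (gt 0 x2) _).
    by rewrite /S -!addeA leeDl// !adde_ge0.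
  by rewrite [in leLHS]x2E; apply: fcd_le_far; rewrite subr0 ltW.
have [x3t|tx3] := leP (enorm (x1 + x2 + y)) (r * tau); last first.
  apply: leS (via3 (gt m3 x2) _).
    by rewrite /S [(gt 0 x2 + _)%E]addeC -!addeA leeDl// !adde_ge0.
  by rewrite x3E; apply: fcd_le_far; rewrite -x3E ltW.
have sqt (x : 'rV[R]_n) : enorm x <= r * tau -> enorm x ^+ 2 <= r ^+ 2 * (1 + 512^-1).
  by move=> xt; rewrite -tau2 -exprMn ler_sqr ?nnegrE ?sqrtr_ge0// mulr_ge0 ?ltW.
have N0 : 0 < r ^+ 2 by rewrite exprn_gt0.
have sq1 : enorm x1 ^+ 2 <= 16 * r ^+ 2 by have := sqt _ x1t; lra.
have nN (u : 'rV[R]_n) : enorm (- u) ^+ 2 = enorm u ^+ 2.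
  by rewrite !sqr_enorm; apply: eq_bigr => i _; rewrite mxE sqrrN.
(* All three norms are now at most [r * tau], so [|y|^2 <= 9 r^2 (1 + 1/512)]. *)
have sqy : enorm (- y) ^+ 2 <= 16 * r ^+ 2.
  have E : x1 + x2 - (x1 + x2 + y) = - y by rewrite opprD addNKr.
  have := sqr_enorm_sum3 x1 x2 (- (x1 + x2 + y)); rewrite E !nN.
  by have := sqt _ x1t; have := sqt _ x2t; have := sqt _ x3t; lra.
have D1 : r ^+ 2 < dot (x1 + x2 + y) x1 - dot x2 x1 - dot y x1.
  have -> : dot (x1 + x2 + y) x1 - dot x2 x1 - dot y x1 = enorm x1 ^+ 2.
    by rewrite sqr_enorm_dot !dotDl; ring.
  by rewrite ltr_sqr ?nnegrE ?sqrtr_ge0// ltW.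
have [d3|d3] := leP (r ^+ 2 / 4) (dot (x1 + x2 + y) x1).
  apply: leS (via3 (b (m3 + 64^-1 *: x1) x2) _).
    by rewrite /S leeDr// !adde_ge0.
  by rewrite x3E; apply: fcd_le_cap; rewrite -?x3E.
have [d2|d2] := leP (r ^+ 2 / 4) (- dot x2 x1).
  apply: leS (via2 (b (- 64^-1 *: x1) x2) _).
    by rewrite /S [X in (X + _)%E]addeC -addeA leeDl// !adde_ge0.
  rewrite [in leLHS]x2E scaleNr -scalerN -[(64^-1 *: - x1)]add0r.
  by apply: fcd_le_cap; rewrite ?subr0 ?nN// dotC dotNl dotC.
(* Both other inner products are below [r^2 / 4], so by [D1] the remaining one, [- dot y x1],
   exceeds [r^2 / 2]: the point [x1] lies in the cap in direction [- y]. *)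
apply: leh; rewrite -[leLHS]add0e leeD//.
rewrite [in leLHS]x1E scaleNr -scalerN -[(64^-1 *: - y)]add0r.
by apply: fcd_le_cap; rewrite ?subr0// dotC dotNl; lra.
Qed.

(** Four light terms in [x2] against [g 0 x1], and two light terms in [x1] against [g 0 x2], account
    for the factor [6 = 4 + 2]. *)
Lemma intRn_triple_le (M k : R) (y : 'rV[R]_n) (C : R) : 0 <= M -> 0 <= k -> 0 <= C ->
  (forall m : 'rV[R]_n, mass_le (g m) M%:E) ->
  (forall m : 'rV[R]_n, mass_le (gt m) k%:E) ->
  B * (ball_scale n * (r * sig)) ^+ n <= k ->
  (intRn (fun x1 => intRn (fun x2 => (C * (f x1 * f x2 * f (x1 + x2 + y)))%:E)) <=
   (C * B * (6 * M * k))%:E)%E.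
Proof.
move=> M0 k0 C0 gM gtk bk.
have bmass (m : 'rV[R]_n) : mass_le (b m) k%:E.
  have [sb Ib] := intRn_ball_majorant_slice n0 m (mulr_gt0 r0 sig0).
  apply: (@mass_leW _ _ _ (B%:E * ((ball_scale n * (r * sig)) ^+ n)%:E)%E); first by rewrite -EFinM lee_fin.
  change (mass_le (fun x => B%:E * (ball_majorant (r * sig) m x)%:E)%E
    (B%:E * ((ball_scale n * (r * sig)) ^+ n)%:E)%E).
  apply: mass_leZ; first by rewrite lee_fin.
  by split=> // [x|]; [rewrite lee_fin ball_majorant_ge0|rewrite Ib].
have CB0 : (0 <= (C * B)%:E)%E by rewrite lee_fin mulr_ge0.
pose h (x1 : 'rV[R]_n) := (gt 0%R x1 + b (- 64^-1 *: y)%R x1)%E.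
have g0 (m x : 'rV[R]_n) : (0 <= g m x)%E by exact: tail_majorant_ge0.
have h0 x : (0 <= h x)%E.
  by rewrite adde_ge0 ?tail_majorant_ge0// lee_fin mulr_ge0 ?ball_majorant_ge0.
(* This bounds the inner integral over [x2], with the masses of the four light terms already
   inserted. *)
pose G (x1 : 'rV[R]_n) := ((C * B)%:E * ((4 * k)%:E * g 0%R x1 + M%:E * h x1))%E.
have mG : mass_le G (C * B * (6 * M * k))%:E.
  have := mass_leZ CB0 (mass_leD
    (mass_leZ (_ : (0 <= (4 * k)%:E)%E) (gM 0)) (mass_leZ (_ : (0 <= M%:E)%E)
      (mass_leD (gtk 0) (bmass (- 64^-1 *: y))))).
  rewrite !lee_fin mulr_ge0// => /(_ isT M0); apply: mass_leW.
  change ((C * B * (4 * k * M + M * (k + k)))%:E <= (C * B * (6 * M * k))%:E)%E.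
  by rewrite lee_fin le_eqVlt; apply/orP; left; apply/eqP; ring.
have ff0 x1 x2 : (0 <= (C * (f x1 * f x2 * f (x1 + x2 + y)))%:E)%E.
  by rewrite lee_fin !mulr_ge0// fcd_ge0.
apply: intRn_le_mass mG => x1; first by apply: intRn_ge0.
have := mass_leZ CB0 (mass_leD (mass_leZ (g0 0 x1) (mass_leD (mass_leD (mass_leD
  (gtk 0) (gtk (- (x1 + y)))) (bmass (- 64^-1 *: x1)))
  (bmass (- (x1 + y) + 64^-1 *: x1)))) (mass_leZ (h0 x1) (gM 0))).
move=> mm; apply: intRn_le_mass (mass_leW _ mm) => //.
- move=> x2; rewrite EFinM [in leRHS]EFinM -muleA lee_wpmul2l ?lee_fin//.
  exact: fcd_triple_le.
- rewrite /G lee_wpmul2l// [X in (_ <= _ + X)%E]muleC [X in (_ <= X + _)%E]muleC.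
  have -> : (4 * k)%:E = (k + k + k + k)%:E :> \bar R by congr (_%:E); ring.
  exact: lexx.
Qed.

End TripleBound.

(** * Counting of factors, cancellation of scales, and the final estimate *)

Lemma index_lt l1 l2 l3 : (0 < l2 -> 0 < l3 -> l1 + l2 - 1 < l1 + l2 + l3 - 1)%N.
Proof. lia. Qed.

(** Counts the factors bounded by [B]: the first index of the third product is left out, since its
    factor is the third one kept. *)
Lemma index_count l1 l2 l3 : (0 < l1 -> 0 < l2 -> 0 < l3 ->
  l1 + l2 + l3 - 3 =
  (l1 - 1) + (l1 + l2 - 1 - l1) + (l1 + l2 + l3 - 1 - (l1 + l2 - 1).+1))%N.
Proof. lia. Qed.

Lemma prod_nat_le_expr (R : realType) (F : nat -> R) (B : R) i j :
  (forall k, 0 <= F k) -> (forall k, F k <= B) ->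
  \prod_(i <= k < j) F k <= B ^+ (j - i).
Proof.
move=> F0 FB; rewrite -prodr_const_nat.
by apply: ler_prod => k _; rewrite F0 FB.
Qed.

(** Here [D = r^n], and [W], [Q], [T] stand for the [n]-th powers of [ball_scale n], [q] and the
    contraction factor. The powers of [D] add up to [2 - s l]; their share of [V] cancels the
    prefactor up to [V^(-2)], which turns [W^2] into [(W / V)^2 <= (K1 Q)^2]. Two more factors [Q]
    come from the two copies of [M]. *)
Lemma scaling_cancels (R : realType) (V d s W Q T K1 K2 M D : R) (l : nat) :
  0 < V -> 0 < d -> (3 <= l)%N -> 0 <= W -> 0 <= Q -> 0 <= T -> W <= K1 * Q * V ->
  D = d / V -> M = K2 * (W * Q * D `^ (1 - s)) ->
  V `^ (- (s * l%:R)) * (D `^ (- s) ^+ (l - 3) * D `^ (- s) * (6 * M * (M * T))) <=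
  6 * K1 ^+ 2 * K2 ^+ 2 * d `^ (2 - s * l%:R) * (Q ^+ 4 * T).
Proof.
move=> V0 d0 l3 W0 Q0 T0 WV DE ME.
have D0 : 0 < D by rewrite DE divr_gt0.
have Dn (x y : R) : D `^ x * D `^ y = D `^ (x + y).
  by rewrite powRD// (gt_eqF D0) implybT.
have DB : D `^ (- s) ^+ (l - 3) * D `^ (- s) * (D `^ (1 - s) * D `^ (1 - s)) =
    d `^ (2 - s * l%:R) * (V `^ (s * l%:R) / V ^+ 2).
  rewrite -exprSr -(powR_mulrn _ (powR_ge0 _ _)) -powRrM !Dn.
  have -> : - s * (l - 3).+1%:R + (1 - s + (1 - s)) = 2 - s * l%:R.
    have -> : (l - 3).+1%:R = l%:R - 2 :> R.
      by apply/(addIr 2); rewrite subrK -natrD addn2 -addn3 subnK.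
    by ring.
  rewrite DE powRM ?invr_ge0 ?(ltW d0) ?(ltW V0)//; congr (_ * _).
  rewrite -powR_inv1 ?(ltW V0)// -powRrM mulN1r opprB powRB; last first.
    by rewrite (gt_eqF V0) implybT.
  by rewrite (powR_mulrn 2 (ltW V0)).
have Vs0 : 0 < V `^ (s * l%:R) by exact: powR_gt0.
have dd0 : 0 <= d `^ (2 - s * l%:R) by exact: powR_ge0.
have -> : V `^ (- (s * l%:R)) *
    (D `^ (- s) ^+ (l - 3) * D `^ (- s) * (6 * M * (M * T))) =
    6 * K2 ^+ 2 * (Q ^+ 2 * T) * d `^ (2 - s * l%:R) * (W / V) ^+ 2.
  transitivity (V `^ (- (s * l%:R)) * (D `^ (- s) ^+ (l - 3) * D `^ (- s)
    * (D `^ (1 - s) * D `^ (1 - s))) * (6 * K2 ^+ 2 * (Q ^+ 2 * T) * W ^+ 2)).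
    by rewrite ME; ring.
  rewrite DB powRN; move: (V `^ _) Vs0 => v v0.
  by field; rewrite !gt_eqF.
have -> : 6 * K1 ^+ 2 * K2 ^+ 2 * d `^ (2 - s * l%:R) * (Q ^+ 4 * T) =
    6 * K2 ^+ 2 * (Q ^+ 2 * T) * d `^ (2 - s * l%:R) * (K1 * Q) ^+ 2 by ring.
apply: ler_wpM2l.
  by rewrite mulr_ge0// mulr_ge0 ?(mulr_ge0 (sqr_ge0 Q) T0)// mulr_ge0 ?sqr_ge0.
have WV' : W / V <= K1 * Q by rewrite ler_pdivrMr.
by rewrite ler_sqr ?nnegrE// ?(le_trans _ WV') ?divr_ge0 ?(ltW V0).
Qed.

(** [th] bounds the gain per dimension in both the far range and the caps; [q ^+ 4] is the total
    loss per dimension from the Gaussian and Gamma bounds. *)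
Lemma contraction_rate (R : realType) (s tau sig : R) : 1 < s -> 1 < tau -> sig < 1 ->
  exists th q : R, [/\ 0 < th, tau `^ (1 - s) <= th, sig <= th, 1 < q & q ^+ 4 * th < 1].
Proof.
move=> s1 t1 sig1; pose th : R := Num.max (tau `^ (1 - s)) sig.
have t0 : 0 < tau by exact: lt_trans t1.
have th1 : th < 1.
  by rewrite gt_max sig1 andbT /powR gt_eqF//= expR_lt1 nmulr_rlt0 ?subr_lt0// ln_gt0.
have th0 : 0 < th by rewrite lt_max powR_gt0.
have lnth : ln th < 0 by rewrite ln_lt0// th0.
(* With this [q], the product [q ^+ 4 * th] is the square root of [th]. *)
exists th, (th `^ (- 8^-1)); split=> //.
- by rewrite le_max lexx.
- by rewrite le_max lexx orbT.
- by rewrite /powR gt_eqF// expR_gt1 nmulr_rgt0// oppr_lt0 invr_gt0.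
- rewrite -(powR_mulrn 4 (powR_ge0 _ _)) -powRrM -[X in _ * X](powRr1 (ltW th0)).
  rewrite -powRD; last by rewrite (gt_eqF th0) implybT.
  rewrite /powR gt_eqF// expR_lt1 pmulr_rlt0//; lra.
Qed.

Lemma exists_sqrt (R : realType) (a : R) : 0 < a -> exists t : R, 0 < t /\ t ^+ 2 = a.
Proof. by move=> a0; exists (Num.sqrt a); rewrite sqrtr_gt0 sqr_sqrtr ?ltW. Qed.

Theorem theorem5p6 (R : realType) (c delta : R) (hc : 1 / 2 < c) (hdelta : 0 < delta)
  (l : nat) (hl : (3 <= l)%N) :
  exists K rho : R, 0 < K /\ 0 < rho /\ rho < 1 /\
  forall (l1 l2 l3 : nat), (0 < l1)%N -> (0 < l2)%N -> (0 < l3)%N ->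
  (l1 + l2 + l3 = l)%N ->
  forall (n : nat), (1 <= n)%N ->
  forall (eps : nat -> bool) (y : nat -> 'rV[R]_n),
  ((@Vn R n `^ (- (2 * l%:R * c)))%:E *
   intRn (fun x1 : 'rV[R]_n => intRn (fun x2 : 'rV[R]_n =>
     (fcd c delta x1
      * (\prod_(1 <= i < l1) fcd c delta (@sgn R (eps i) *: x1 + y i))
      * fcd c delta x2
      * (\prod_(l1 <= i < l1 + l2 - 1) fcd c delta (@sgn R (eps i) *: x2 + y i))
      * (\prod_(l1 + l2 - 1 <= i < l - 1)
           fcd c delta (@sgn R (eps i) *: (x1 + x2) + y i)))%:E))
   <= (K * rho ^+ n)%:E)%E.
Proof.
have s1 : 1 < 2 * c by lra.
have [|tau [tau0 tau2]] := @exists_sqrt R (1 + 512^-1); first lra.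
have [|sig [sig0 sig2]] := @exists_sqrt R (1 - 512^-1); first lra.
have tau1 : 1 < tau by rewrite -ltr_sqr ?nnegrE ?(ltW tau0)// tau2 expr1n; lra.
have sig1 : sig < 1 by rewrite -ltr_sqr ?nnegrE ?(ltW sig0)// sig2 expr1n; lra.
have [th [q [th0 thtau thsig q1 rho1]]] := contraction_rate s1 tau1 sig1.
have q0 : 0 < q by exact: lt_trans q1.
(* [K1] comes from the Gamma bound and [K2] from the geometric series. Since [tau] and [sig] are
   numerical, [q] and both constants depend on [c] only. *)
pose K1 : R := (1 - q ^- 2)^-1; pose K2 : R := (1 - q `^ (1 - 2 * c))^-1.
have K10 : 0 < K1 by rewrite invr_gt0 subr_gt0 invf_lt1 ?exprn_gt0// exprn_egt1.
have qs : q `^ (1 - 2 * c) < 1.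
  by rewrite /powR gt_eqF// expR_lt1 nmulr_rlt0 ?subr_lt0// ln_gt0.
have K20 : 0 < K2 by rewrite invr_gt0 subr_gt0.
have K21 : 1 <= K2.
  by rewrite -invr1 lef_pV2 ?posrE ?subr_gt0// gerBl powR_ge0.
pose K := 6 * K1 ^+ 2 * K2 ^+ 2 * delta `^ (2 - 2 * c * l%:R).
have K0 : 0 < K by rewrite !mulr_gt0 ?exprn_gt0 ?powR_gt0.
have rho0 : 0 < q ^+ 4 * th by rewrite mulr_gt0 ?exprn_gt0.
exists K, (q ^+ 4 * th); split=> //; split=> //.
split=> // l1 l2 l3 l10 l20 l30 lE n n0 eps y.
have nR0 : 0 < n%:R :> R by rewrite ltr0n.
have [V0|V0] := eqVneq (@Vn R n) 0.
  (* A nonzero power of [0] is [0], so in this case the prefactor vanishes. *)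
  have lc : - (2 * l%:R * c) != 0.
    rewrite oppr_eq0 gt_eqF// mulr_gt0 ?mulr_gt0 ?ltr0n ?(leq_trans _ hl)//; lra.
  by rewrite V0 powR0// mul0e lee_fin mulr_ge0 ?(ltW K0)// exprn_ge0// ltW.
have Vgt0 : 0 < @Vn R n by rewrite lt_neqAle eq_sym V0 Vn_ge0.
pose D := delta / @Vn R n.
have D0 : 0 < D by rewrite divr_gt0.
pose r : R := Rn n delta.
have r0 : 0 < r by exact: powR_gt0.
have rD a : r `^ (a * n%:R) = D `^ a.
  by rewrite /r /Rn -/D -powRrM mulrCA mulVf ?mulr1// gt_eqF.
pose B : R := r `^ (- (2 * c * n%:R)).
have BD : B = D `^ (- (2 * c)) by rewrite /B -mulNr rD.
have B0 : 0 <= B by exact: powR_ge0.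
pose w : R := ball_scale n.
have w0 : 0 <= w by exact: ball_scale_ge0.
pose M : R := K2 * ((w * q) ^+ n * r `^ ((1 - 2 * c) * n%:R)).
have M0 : 0 <= M.
  by rewrite !mulr_ge0 ?powR_ge0 ?(ltW K20)// exprn_ge0// mulr_ge0// ltW.
have thn0 : 0 <= th ^+ n by rewrite exprn_ge0 ?ltW.
have tail_mass t (m : 'rV[R]_n) : 0 < t -> mass_le (tail_majorant q (2 * c * n%:R) t m)
    (K2 * ((w * q) ^+ n * t `^ ((1 - 2 * c) * n%:R)))%:E.
  move=> t0; have [sT IT] := intRn_tail_majorant_slice n0 m q1 t0 s1.
  by split=> // x; exact: tail_majorant_ge0.
have far_mass (m : 'rV[R]_n) :
    mass_le (tail_majorant q (2 * c * n%:R) (r * tau) m) (M * th ^+ n)%:E.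
  apply: mass_leW (tail_mass _ _ (mulr_gt0 r0 tau0)).
  rewrite lee_fin /M -!mulrA ler_pM2l// ler_wpM2l ?exprn_ge0 ?mulr_ge0 ?(ltW q0)//.
  rewrite powRM ?(ltW r0) ?(ltW tau0)// ler_wpM2l ?powR_ge0//.
  rewrite powRrM powR_mulrn ?powR_ge0//.
  by apply: lerXn2r; rewrite ?nnegrE ?powR_ge0 ?(ltW th0).
(* [B * r ^+ n] scales like the mass bound [M]; the surplus factors [K2] and [q ^+ n] of [M] are at
   least 1, and [sig ^+ n] is absorbed by [th ^+ n]. *)
have cap_mass : B * (w * (r * sig)) ^+ n <= M * th ^+ n.
  have BE : B * r ^+ n = r `^ ((1 - 2 * c) * n%:R).
    rewrite -(powR_mulrn n (ltW r0)) -powRD; last by rewrite (gt_eqF r0) implybT.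
    by congr (_ `^ _); ring.
  have -> : B * (w * (r * sig)) ^+ n =
      w ^+ n * (r `^ ((1 - 2 * c) * n%:R)) * sig ^+ n.
    by rewrite -BE !exprMn; ring.
  apply: ler_pM; rewrite ?mulr_ge0 ?powR_ge0 ?exprn_ge0 ?(ltW sig0)//; last first.
    by apply: lerXn2r; rewrite ?nnegrE ?(ltW sig0) ?(ltW th0).
  rewrite /M mulrA ler_wpM2r ?powR_ge0// [(w * q) ^+ n]exprMn mulrCA -[leLHS]mulr1.
  rewrite ler_wpM2l ?exprn_ge0// -[leLHS]mulr1 ler_pM// exprn_ege1// ltW//.
have f0 (x : 'rV[R]_n) : 0 <= fcd c delta x by exact: fcd_ge0.
have fB (x : 'rV[R]_n) : fcd c delta x <= B by exact: fcd_le.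
(* The first index of the third product, nonempty because [l3] is positive; its factor becomes the
   third point. *)
pose i0 := (l1 + l2 - 1)%N.
have i0l : (i0 < l - 1)%N by rewrite /i0 -lE; exact: index_lt.
have main := intRn_triple_le n0 hc q1 r0 tau0 tau2 sig0 sig2 (sgn R (eps i0) *: y i0) M0 (mulr_ge0 M0 thn0)
  (exprn_ge0 (l - 3) B0) (fun m => tail_mass r m r0) far_mass cap_mass.
apply: (@le_trans _ _ ((@Vn R n `^ (- (2 * l%:R * c)))%:E *
  (B ^+ (l - 3) * B * (6 * M * (M * th ^+ n)))%:E)%E).
  rewrite lee_wpmul2l ?lee_fin ?powR_ge0//; apply: le_trans main.
  apply: intRn_mono => x1.
    by apply: intRn_ge0 => x2; rewrite lee_fin !mulr_ge0 ?prodr_ge0.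
  apply: intRn_mono => x2; rewrite lee_fin; first by rewrite !mulr_ge0 ?prodr_ge0.
  rewrite (big_ltn i0l).
  have -> : fcd c delta (sgn R (eps i0) *: (x1 + x2) + y i0) =
      fcd c delta (x1 + x2 + sgn R (eps i0) *: y i0) by rewrite /fcd enorm_scale_sgn.
  have P1 := @prod_nat_le_expr R (fun i => fcd c delta (sgn R (eps i) *: x1 + y i)) B 1 l1
    (fun=> f0 _) (fun=> fB _).
  have P2 := @prod_nat_le_expr R (fun i => fcd c delta (sgn R (eps i) *: x2 + y i)) B l1 i0
    (fun=> f0 _) (fun=> fB _).
  have P3 := @prod_nat_le_expr R
    (fun i => fcd c delta (sgn R (eps i) *: (x1 + x2) + y i)) B i0.+1 (l - 1)
    (fun=> f0 _) (fun=> fB _).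
  have -> : B ^+ (l - 3) = B ^+ (l1 - 1) * B ^+ (i0 - l1) * B ^+ (l - 1 - i0.+1).
    by rewrite -!exprD /i0 -lE -index_count.
  move: P1 P2 P3; rewrite -/i0.
  set p1 := \prod_(1 <= _ < _) _; set p2 := \prod_(l1 <= _ < _) _.
  set p3 := \prod_(i0.+1 <= _ < _) _ => P1 P2 P3.
  have p10 : 0 <= p1 by exact: prodr_ge0.
  have p20 : 0 <= p2 by exact: prodr_ge0.
  have p30 : 0 <= p3 by exact: prodr_ge0.
  set f1 := fcd c delta x1; set f2 := fcd c delta x2; set f3 := fcd c delta (x1 + x2 + _).
  have -> : f1 * p1 * f2 * p2 * (f3 * p3) = p1 * p2 * p3 * (f1 * f2 * f3) by ring.
  have fff : 0 <= f1 * f2 * f3 by apply: mulr_ge0; [apply: mulr_ge0|]; exact: f0.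
  apply: (ler_wpM2r fff).
  exact: (ler_pM (mulr_ge0 p10 p20) p30 (ler_pM p10 p20 P1 P2) P3).
rewrite -EFinM lee_fin BD -mulrAC.
have WV := ball_scale_le_Vn n0 q1 V0.
rewrite [(q ^+ 4 * th) ^+ n]exprMn -exprM mulnC exprM.
apply: (@scaling_cancels R _ _ _ (w ^+ n)) => //; rewrite ?exprn_ge0 ?(ltW q0)//.
by rewrite /M rD [(w * q) ^+ n]exprMn.
Qed.
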